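(* For $\theta\in[0,\pi]$ and $\tau\ge0$ let $\rho(\tau,\theta)$ be the function (with a Dirac mass at $\tau=1$) defined in the context. Then $\rho(\tau,\theta)$ is strictly positive for all $(\tau,\theta)\in[0,\infty)\times[0,\pi]$ outside the region $$N_{\mathrm{segm}}=\Big\{1-\tfrac{\theta}{2\pi+\bar\alpha}\le\tau\le1,\ 0\le\theta\le\hat\theta\Big\}\cup\{\theta=0\}\cup\{\tau=1,\ \theta\in[2\bar\alpha,\pi]\},$$ where $\hat\theta\in[0,\pi]$ is the unique solution of $$\cot(\bar\alpha)\frac{1-\cos\hat\theta}{\sin\bar\alpha}-e^{-\cot(\bar\alpha)(2\pi+\bar\alpha-\hat\theta)}=0.$$ (At $\tau=1$, positivity is understood as positivity of the coefficient $D(\theta)$ of the Dirac mass.) Moreover, as $\tau\to\infty$, $\rho$ diverges like $$\lim_{\tau\to\infty}\frac{\rho(\tau,\theta)}{\tau}=2\,(S_0+S_1+S_2+S_3),\qquad 2\,(S_0+S_1+S_2+S_3)\in\theta^2\,(0.08,\,0.28)\quad(\theta\in(0,\pi]).$$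
   Context: $\bar\alpha\in(0,\pi/2)$ is the unique solution of $(2\pi+\bar\alpha)\cot\bar\alpha-\ln\frac{2\pi+\bar\alpha}{\sin\bar\alpha}=1$ ($\bar\alpha\approx1.1783$), and $\bar c=\cot\bar\alpha-\frac1{2\pi+\bar\alpha}=\frac1{2\pi+\bar\alpha}\ln\frac{2\pi+\bar\alpha}{\sin\bar\alpha}$. Let $$g(\tau)=\sum_{k=0}^\infty(-1)^k e^{\tau-k}\frac{(\tau-k)^k}{k!}\mathbf 1_{[k,\infty)}(\tau),$$ the Green kernel of $\dot g(\tau)=g(\tau)-g(\tau-1)+\delta_0$. For $\theta\in[0,\pi]$ put $\tau_1=1-\frac{\theta}{2\pi+\bar\alpha}$ and $$\rho(\tau,\theta)=S_0\,g(\tau)+S_1\,g(\tau-\tau_1)+S_2\,g(\tau-1)+D\,\delta_1+S_3\,g(\tau-2),$$ where $$S_0=\cot(\bar\alpha)\frac{1-\cos\theta}{\sin\bar\alpha},\qquad S_1=-\frac{\sin\bar\alpha}{2\pi+\bar\alpha}e^{\bar c\theta},$$ $$S_2=\frac{\sin\bar\alpha}{2\pi+\bar\alpha}-\frac{1-\cos\theta}{(2\pi+\bar\alpha)\sin\bar\alpha}+\frac{\cot\bar\alpha}{2\pi+\bar\alpha}\big(\cos(\bar\alpha-\theta)-\cos\bar\alpha\big),$$ $$D=\frac{\cos(\bar\alpha-\theta)-\cos\bar\alpha}{2\pi+\bar\alpha},\qquad S_3=-\frac{\cos(\bar\alpha-\theta)-\cos\bar\alpha}{(2\pi+\bar\alpha)^2}.$$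 This is the rescaling $\rho(\tau)=\delta\tilde r(\phi_0+\bar\theta-\bar\alpha+(2\pi+\bar\alpha)\tau)e^{-\bar c(2\pi+\bar\alpha)\tau}$ of the derivative $\delta\tilde r$, with respect to the starting point, of the ray length of the family of fastest saturated spirals, $\theta$ being the angle between the given spiral and the initial segment of the fastest saturated spiral. *)

(* Defs.v *)
From Stdlib Require Import Reals Ranalysis5 Factorial Lra.
From Coquelicot Require Import Coquelicot.
Open Scope R_scope.

Definition cot (x : R) : R := cos x / sin x.

(** [alpha] is the angle written "alpha bar"; it exists and is unique by
    [bar_alpha_exists_unique] below. *)
Definition is_bar_alpha (alpha : R) : Prop :=
  0 < alpha < PI / 2 /\
  (2 * PI + alpha) * cot alpha - ln ((2 * PI + alpha) / sin alpha) = 1.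

Definition bar_c (alpha : R) : R := cot alpha - 1 / (2 * PI + alpha).

(** For each [tau] only the finitely many terms with [k <= tau] are nonzero, so
    the series converges; the term [k = 0] is [exp tau], with [0 ^ 0 = 1]. *)
Definition g (tau : R) : R :=
  Series (fun k : nat =>
    if Rle_dec (INR k) tau
    then (-1) ^ k * exp (tau - INR k) * ((tau - INR k) ^ k / INR (fact k))
    else 0).

Definition tau1 (alpha theta : R) : R := 1 - theta / (2 * PI + alpha).

Definition S0 (alpha theta : R) : R :=
  cot alpha * ((1 - cos theta) / sin alpha).

Definition S1 (alpha theta : R) : R :=
  - (sin alpha / (2 * PI + alpha)) * exp (bar_c alpha * theta).

Definition S2 (alpha theta : R) : R :=
  sin alpha / (2 * PI + alpha)
  - (1 - cos theta) / ((2 * PI + alpha) * sin alpha)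
  + cot alpha / (2 * PI + alpha) * (cos (alpha - theta) - cos alpha).

Definition D (alpha theta : R) : R :=
  (cos (alpha - theta) - cos alpha) / (2 * PI + alpha).

Definition S3 (alpha theta : R) : R :=
  - ((cos (alpha - theta) - cos alpha) / (2 * PI + alpha) ^ 2).

(** [rho = rho_reg + D * delta_1]: a function of [tau], plus a single Dirac
    mass, of coefficient [D alpha theta], located at [tau = 1]. *)
Definition rho_reg (alpha tau theta : R) : R :=
  S0 alpha theta * g tau
  + S1 alpha theta * g (tau - tau1 alpha theta)
  + S2 alpha theta * g (tau - 1)
  + S3 alpha theta * g (tau - 2).

(** Strict positivity of [rho] at [(tau, theta)]: at [tau = 1] the condition is
    on the coefficient of the Dirac mass, elsewhere on the value of [rho]. *)
Definition rho_pos (alpha tau theta : R) : Prop :=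
  (tau = 1 -> 0 < D alpha theta) /\
  (tau <> 1 -> 0 < rho_reg alpha tau theta).

Definition is_hat_theta (alpha theta : R) : Prop :=
  0 <= theta <= PI /\
  cot alpha * ((1 - cos theta) / sin alpha)
  - exp (- cot alpha * (2 * PI + alpha - theta)) = 0.

Definition N_segm (alpha hat_theta tau theta : R) : Prop :=
  (1 - theta / (2 * PI + alpha) <= tau <= 1 /\ 0 <= theta <= hat_theta)
  \/ theta = 0
  \/ (tau = 1 /\ 2 * alpha <= theta <= PI).

Lemma bar_c_alt (alpha : R) : is_bar_alpha alpha ->
  bar_c alpha = 1 / (2 * PI + alpha) * ln ((2 * PI + alpha) / sin alpha).
Proof.
intros [Ha He]; unfold bar_c.
replace (ln ((2 * PI + alpha) / sin alpha))
  with ((2 * PI + alpha) * cot alpha - 1) by lra.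
assert (H := PI_RGT_0); field; lra.
Qed.

Lemma bar_alpha_exists_unique : exists! alpha : R, is_bar_alpha alpha.
Proof.
assert (HPI : 3 < PI) by (assert (H := PI2_3_2); unfold PI2 in *; lra).
assert (HPI4 := PI_4).
set (h := fun a => (2 * PI + a) * cot a - ln ((2 * PI + a) / sin a)).
set (h' := fun a => (2 * (sin a * cos a) - (2 * PI + a)) / (sin a) ^ 2
                    - / (2 * PI + a)).
assert (Hsin : forall a, 0 < a <= PI / 2 -> 0 < sin a)
  by (intros a Ha; apply sin_gt_0; lra).
assert (Hd : forall a, 0 < a <= PI / 2 -> is_derive h a (h' a)).
{ intros a Ha; assert (Hs := Hsin a Ha).
  assert (Hc : cos a * cos a = 1 - sin a * sin a)
    by (assert (H := sin2_cos2 a); unfold Rsqr in H; lra).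
  unfold h, h', cot; auto_derive.
  - repeat split; try lra. apply Rdiv_lt_0_compat; lra.
  - replace (2 * (sin a * cos a) - (2 * PI + a))
      with (2 * (sin a * cos a)
            - (2 * PI + a) * (cos a * cos a + sin a * sin a))
      by (rewrite Hc; ring).
    field; lra. }
assert (Hneg : forall a, 0 < a <= PI / 2 -> h' a < 0).
{ intros a Ha; assert (Hs := Hsin a Ha); unfold h'.
  assert (Hb := SIN_bound a); assert (Hb' := COS_bound a).
  assert (0 < (2 * PI + a - 2 * (sin a * cos a)) / (sin a) ^ 2)
    by (apply Rdiv_lt_0_compat; nra).
  replace ((2 * (sin a * cos a) - (2 * PI + a)) / sin a ^ 2)
    with (- ((2 * PI + a - 2 * (sin a * cos a)) / sin a ^ 2)) by (field; lra).
  assert (0 < / (2 * PI + a)) by (apply Rinv_0_lt_compat; lra).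
  lra. }
assert (Hdec : forall a b, 0 < a -> a < b -> b <= PI / 2 -> h b < h a).
{ intros a b Ha Hab Hb.
  destruct (MVT_cor2 h h' a b Hab) as [x [Hx Hx']].
  - intros x Hx; apply is_derive_Reals, Hd; lra.
  - assert (H := Hneg x ltac:(lra)); nra. }
assert (Hl : 1 < h (PI / 4)).
{ assert (Hln : forall x, 0 < x -> ln x <= 1 + x / 4).
  { intros x Hx.
    replace (ln x) with (ln (x / 4) + 2 * ln 2).
    - assert (H := ln_lt_2); assert (H2 : ln 2 < 1).
      { rewrite <- (ln_exp 1); apply ln_increasing; [lra|].
        assert (H' := exp_ineq1 1); lra. }
      assert (H3 := exp_ineq1_le (ln (x / 4))); rewrite exp_ln in H3; lra.
    - replace (2 * ln 2) with (ln 4).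
      + rewrite <- ln_mult; [f_equal; field|lra|lra].
      + replace 4 with (2 * 2) by lra; rewrite ln_mult; lra. }
  assert (Hs := Hsin (PI / 4) ltac:(lra)).
  assert (Hsq : sin (PI / 4) * sin (PI / 4) = 1 / 2).
  { assert (H := sin2_cos2 (PI / 4)); unfold Rsqr in H.
    rewrite <- sin_cos_PI4 in H; lra. }
  unfold h, cot; rewrite <- sin_cos_PI4.
  replace (sin (PI / 4) / sin (PI / 4)) with 1 by (field; lra).
  assert (Hi : / sin (PI / 4) <= 2).
  { replace (/ sin (PI / 4)) with (2 * sin (PI / 4)).
    - assert (H := SIN_bound (PI / 4)); lra.
    - apply Rmult_eq_reg_r with (sin (PI / 4)); [|lra].
      rewrite Rinv_l; lra. }
  assert (H := Hln ((2 * PI + PI / 4) / sin (PI / 4))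
                 ltac:(apply Rdiv_lt_0_compat; lra)).
  assert ((2 * PI + PI / 4) / sin (PI / 4) <= (2 * PI + PI / 4) * 2)
    by (unfold Rdiv at 1; apply Rmult_le_compat_l; lra).
  lra. }
assert (Hr : h (PI / 2) < 1).
{ unfold h, cot; rewrite cos_PI2, sin_PI2.
  assert (0 < ln ((2 * PI + PI / 2) / 1)); [|lra].
  rewrite <- ln_1; apply ln_increasing; lra. }
destruct (Ranalysis5.IVT_interv (fun a => 1 - h a) (PI / 4) (PI / 2)) as [a [Ha He]];
  [|lra|lra|lra|].
{ intros a Ha; apply continuity_pt_minus.
  - apply continuity_pt_const; intros x y; reflexivity.
  - apply derivable_continuous_pt; exists (h' a); apply is_derive_Reals, Hd; lra. }
assert (Ha2 : a <> PI / 2) by (intros ->; lra).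
exists a; split.
- split; [lra|]; fold (h a); lra.
- intros b [Hb Eb]; fold (h b) in Eb.
  destruct (Rtotal_order a b) as [H|[H|H]]; [|exact H|].
  + assert (H' := Hdec a b ltac:(lra) H ltac:(lra)); lra.
  + assert (H' := Hdec b a ltac:(lra) H ltac:(lra)); lra.
Qed.

(* Main.v *)
Require Import Defs.
From Stdlib Require Import Reals Lra Lia Factorial.
From Coquelicot Require Import Coquelicot.
Open Scope R_scope.

(** Write [L = 2 PI + alpha], [q = cot alpha], [c = bar_c alpha = q - 1/L].

The delay equation of the kernel has a conserved quantity: for [t >= 0],
[g t] equals [1] plus the integral of [g] over [[t - 1, t]] ([is_RInt_g_mean]).
By linearity, once all four sources have been switched on, that is for
[tau >= 2], the value [rho_reg tau] equals the mean of [rho_reg] over the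
preceding unit interval plus the total mass [S0 + S1 + S2 + S3].  A function
that exceeds its preceding mean by a positive constant and is nonnegative on
one initial interval of unit length stays positive ([mean_renewal_pos]): at a
nonpositive minimum it would be at least that minimum plus the constant.  Hence
positivity for [tau >= 2] follows from positivity on [(1, 2)] and of the total
mass.  The same principle, applied to [g] compared with lines of slope
[2 - e] and [2 + e], bounds [g t - 2 t], which gives the limit of
[rho_reg tau / tau].

On [(1, 2)] the kernel is explicit, and dropping terms of a good sign bounds
[rho_reg] below by [exp (tau - 1)] times a quantity independent of [tau].  Both
this quantity and the total mass turn out to be [sin alpha / L] times a function
of the form [K (1 - cos t) + 1 + k sin t - exp (k t)], where [k] is respectively
[q] and [c] ([second_turn_value], [total_mass]).  Such a function vanishes to
second order at [t = 0]; divided by [t^2] it is at most [(K - k^2) / 2], its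
limit at [0], and on [[0, PI]] at least its value at [PI], because
each of the three functions [(1 - cos t) / t^2], [(sin t - t) / t^2] and
[(1 + k t - exp (k t)) / t^2] is at least its value at [PI]
([trig_exp_lower_bound], [trig_exp_upper_bound]).  Everything is thus reduced to
inequalities between numbers, which hold as soon as [alpha] is known to lie in
[(1.178, 1.179)].

For [tau < 1] only the sources at [0] and [tau1] act, and the
equation for [alpha] turns positivity after [tau1] into the inequality that
defines [hat_theta].  That this inequality holds exactly beyond [hat_theta]
comes from the monotonicity of [(1 - cos t) exp (- q t)], which increases up
to [t = 2 alpha] and then decreases to a value at [PI] that is still above the
threshold ([hat_theta_spec]).  The coefficient of the Dirac mass is positive
precisely for [0 < t < 2 alpha]. *)

(** * The Green kernel *)

(** The summand of [g] without its cut-off, hence differentiable on the whole line. *)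
Definition smooth_term (k : nat) (t : R) : R :=
  (-1) ^ k * exp (t - INR k) * ((t - INR k) ^ k / INR (fact k)).

Definition term (k : nat) (t : R) : R :=
  if Rle_dec (INR k) t then smooth_term k t else 0.

Lemma term_eq0 k t : t < INR k -> term k t = 0.
Proof. intros H; unfold term; destruct (Rle_dec (INR k) t); lra. Qed.

Lemma term_eq k t : INR k <= t -> term k t = smooth_term k t.
Proof. intros H; unfold term; destruct (Rle_dec (INR k) t); lra. Qed.

Lemma g_partial_sum N t :
  t < INR (S N) -> g t = sum_f_R0 (fun k => term k t) N.
Proof.
intros Ht; apply is_series_unique.
apply filterlim_ext_loc with (fun _ => sum_f_R0 (fun k => term k t) N);
  [|apply filterlim_const].
exists N; intros n Hn; rewrite sum_n_Reals.
induction Hn as [|n Hn IH]; [reflexivity|].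
rewrite tech5, <- IH.
assert (INR (S N) <= INR (S n)) by (apply le_INR; lia).
change (sum_f_R0 (fun k => term k t) N
        = sum_f_R0 (fun k => term k t) N + term (S n) t).
rewrite (term_eq0 (S n)); lra.
Qed.

Lemma g_neg t : t < 0 -> g t = 0.
Proof.
intros Ht; rewrite (g_partial_sum 0) by (simpl; lra).
apply term_eq0; simpl; lra.
Qed.

Lemma g_unit t : 0 <= t < 1 -> g t = exp t.
Proof.
intros Ht; rewrite (g_partial_sum 0) by (simpl; lra).
change (term 0 t = exp t); rewrite term_eq by (simpl; lra).
unfold smooth_term; simpl; rewrite Rminus_0_r; field.
Qed.

Lemma g_second t : 1 <= t < 2 -> g t = exp t - (t - 1) * exp (t - 1).
Proof.
intros Ht; rewrite (g_partial_sum 1) by (simpl; lra).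
change (term 0 t + term 1 t = exp t - (t - 1) * exp (t - 1)).
rewrite !term_eq by (simpl; lra).
unfold smooth_term; simpl; rewrite Rminus_0_r; field.
Qed.

Lemma g_le_exp t : t < 2 -> g t <= exp t.
Proof.
intros Ht; assert (He := exp_pos t); assert (He1 := exp_pos (t - 1)).
destruct (Rlt_le_dec t 0) as [H|H]; [rewrite g_neg; lra|].
destruct (Rlt_le_dec t 1) as [H1|H1]; [rewrite g_unit; lra|].
rewrite g_second by lra; nra.
Qed.

Lemma continuous_smooth_term k t : continuous (smooth_term k) t.
Proof.
apply (ex_derive_continuous (smooth_term k)).
unfold smooth_term; auto_derive; trivial.
Qed.

(** Differentiating the exponential reproduces the term; differentiating the
    power lowers its degree and yields the previous term delayed by one. *)
Lemma is_derive_smooth_term k t :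
  is_derive (smooth_term (S k)) t (smooth_term (S k) t - smooth_term k (t - 1)).
Proof.
assert (Hf : INR (fact k) <> 0) by apply INR_fact_neq_0.
assert (HSk : INR (S k) <> 0) by (apply not_0_INR; lia).
unfold smooth_term.
replace (t - 1 - INR k) with (t - INR (S k)) by (rewrite S_INR; ring).
rewrite fact_simpl, mult_INR.
set (n := INR (S k)) in *.
auto_derive; trivial.
change (match k with 0%nat => 1 | S _ => INR k + 1 end) with n.
change (t + - n) with (t - n).
rewrite <- !tech_pow_Rmult; field; auto.
Qed.

Lemma ex_RInt_truncated (P : R -> R) c a b :
  (forall x, continuous P x) ->
  ex_RInt (fun s => if Rle_dec c s then P s else 0) a b.
Proof.
intros HP.
assert (Hle : forall x y, x <= y ->
          ex_RInt (fun s => if Rle_dec c s then P s else 0) x y).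
{ intros x y Hxy.
  assert (HR : forall u v, c <= u <= v ->
            ex_RInt (fun s => if Rle_dec c s then P s else 0) u v).
  { intros u v Huv; apply ex_RInt_ext with P.
    - intros s; rewrite Rmin_left, Rmax_right by lra; intros Hs.
      destruct (Rle_dec c s); lra.
    - apply (ex_RInt_continuous (V := R_CompleteNormedModule)); auto. }
  assert (HL : forall u v, u <= v <= c ->
            ex_RInt (fun s => if Rle_dec c s then P s else 0) u v).
  { intros u v Huv; apply ex_RInt_ext with (fun _ => 0).
    - intros s; rewrite Rmin_left, Rmax_right by lra; intros Hs.
      destruct (Rle_dec c s); lra.
    - apply ex_RInt_const. }
  destruct (Rle_lt_dec c x); [apply HR; lra|].
  destruct (Rle_lt_dec y c); [apply HL; lra|].
  apply ex_RInt_Chasles with c; [apply HL|apply HR]; lra. }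
destruct (Rle_lt_dec a b); [auto|].
apply ex_RInt_swap, Hle; lra.
Qed.

Lemma ex_RInt_g a b : ex_RInt g a b.
Proof.
destruct (nfloor_ex (Rabs (Rmax a b)) (Rabs_pos _)) as [N [_ HN]].
apply ex_RInt_ext with (fun s => sum_f_R0 (fun k => term k s) N).
- intros s [_ Hs]; symmetry; apply g_partial_sum.
  assert (H := Rle_abs (Rmax a b)); rewrite S_INR; lra.
- clear HN; induction N as [|N IH]; simpl.
  + apply ex_RInt_truncated, continuous_smooth_term.
  + apply (ex_RInt_plus (V := R_NormedModule)); [exact IH|].
    apply (ex_RInt_truncated (smooth_term (S N))), continuous_smooth_term.
Qed.

(** The [k]-th summand is the response to the delayed [(k-1)]-st one.  The
    integral form holds across the switching time [S k], where the summand
    vanishes but, for [k = 0], has a corner. *)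
Lemma is_RInt_term_dde k t : 0 <= t ->
  is_RInt (fun s => term (S k) s - term k (s - 1)) 0 t (term (S k) t).
Proof.
intros Ht.
assert (Hk : 0 < INR (S k)) by (apply lt_0_INR; lia).
assert (HS : INR (S k) = INR k + 1) by apply S_INR.
assert (Hz : forall u, 0 <= u <= INR (S k) ->
  is_RInt (fun s => term (S k) s - term k (s - 1)) 0 u 0).
{ intros u Hu; apply is_RInt_ext with (fun _ => 0).
  - intros s; rewrite Rmin_left, Rmax_right by lra; intros Hs.
    rewrite !term_eq0; lra.
  - replace 0 with (scal (u - 0) 0) at 2 by (unfold scal; simpl; unfold mult; simpl; ring).
    apply (is_RInt_const (V := R_NormedModule)). }
destruct (Rlt_le_dec t (INR (S k))) as [H|H].
- rewrite (term_eq0 (S k) t) by lra; apply Hz; lra.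
- replace (term (S k) t)
    with (plus 0 (minus (smooth_term (S k) t) (smooth_term (S k) (INR (S k))))).
  2: { assert (H0 : smooth_term (S k) (INR (S k)) = 0).
       { unfold smooth_term; rewrite Rminus_diag, pow_i by lia.
         unfold Rdiv; ring. }
       rewrite H0, term_eq by lra; unfold plus, minus, opp; simpl.
       unfold plus; simpl; ring. }
  apply (is_RInt_Chasles (V := R_NormedModule)) with (INR (S k)); [apply Hz; lra|].
  apply is_RInt_ext with (fun s => smooth_term (S k) s - smooth_term k (s - 1)).
  + intros s; rewrite Rmin_left, Rmax_right by lra; intros Hs.
    rewrite !term_eq; lra.
  + apply (is_RInt_derive (V := R_CompleteNormedModule)).
    * intros s _; apply is_derive_smooth_term.
    * intros s _; apply (continuous_minus (V := R_NormedModule)).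
      -- apply continuous_smooth_term.
      -- apply (continuous_comp (fun s => s - 1) (smooth_term k)).
         ++ apply (continuous_minus (V := R_NormedModule));
              [apply continuous_id|apply continuous_const].
         ++ apply continuous_smooth_term.
Qed.

Lemma is_RInt_term0 t : 0 <= t -> is_RInt (term 0) 0 t (term 0 t - 1).
Proof.
intros Ht.
assert (He : forall s, 0 <= s -> term 0 s = exp s).
{ intros s Hs; rewrite term_eq by (simpl; lra).
  unfold smooth_term; simpl; rewrite Rminus_0_r; field. }
rewrite He, <- exp_0 by lra.
apply is_RInt_ext with exp.
- intros s; rewrite Rmin_left, Rmax_right by lra; intros Hs; rewrite He; lra.
- apply (is_RInt_derive (V := R_CompleteNormedModule)).
  + intros s _; apply is_derive_exp.
  + intros s _; apply continuous_exp.
Qed.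

(** Integrated form of the delay equation: the constant [1] is the Dirac mass at
    time [0].  It telescopes from the equations of the single summands. *)
Lemma is_RInt_g_dde t : 0 <= t ->
  is_RInt (fun s => g s - g (s - 1)) 0 t (g t - 1).
Proof.
intros Ht.
destruct (nfloor_ex t Ht) as [N [_ HN]].
set (Sg := fun s => sum_f_R0 (fun k => term k s) N).
assert (H : is_RInt (fun s => Sg s - (Sg (s - 1) - term N (s - 1))) 0 t (Sg t - 1)).
{ unfold Sg; clear HN Sg; induction N as [|N IH]; simpl sum_f_R0.
  - apply is_RInt_ext with (term 0); [intros s _; simpl; ring|].
    now apply is_RInt_term0.
  - generalize (is_RInt_plus _ _ _ _ _ _ IH (is_RInt_term_dde N t Ht)).
    replace (sum_f_R0 (fun k => term k t) N + term (S N) t - 1)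
      with (plus (sum_f_R0 (fun k => term k t) N - 1) (term (S N) t))
      by (unfold plus; simpl; ring).
    apply is_RInt_ext; intros s _; unfold plus; simpl; ring. }
rewrite (g_partial_sum N) by (rewrite S_INR; lra).
revert H; apply is_RInt_ext.
intros s; rewrite Rmin_left, Rmax_right by lra; intros Hs.
rewrite (g_partial_sum N s), (g_partial_sum N (s - 1)) by (rewrite S_INR; lra).
fold (Sg s) (Sg (s - 1)); rewrite term_eq0; lra.
Qed.

(** The conservation law of the delay equation: since [g] is zero before time
    [0], the two integrals of the delay equation cancel except on [[t - 1, t]]. *)
Lemma is_RInt_g_mean t : 0 <= t -> is_RInt g (t - 1) t (g t - 1).
Proof.
intros Ht.
assert (Hex := ex_RInt_g).
replace (g t - 1) with (RInt g (t - 1) t); 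
  [apply (RInt_correct (V := R_CompleteNormedModule)), Hex|].
assert (Hsh : is_RInt (fun s => g (s - 1)) 0 t (RInt g (-1) (t - 1))).
{ apply is_RInt_ext with (fun s => scal 1 (g (1 * s + -1))).
  - intros s _; rewrite (Rmult_1_l s); apply (scal_one (g (s + -1))).
  - apply (is_RInt_comp_lin (V := R_NormedModule) g 1 (-1)).
    replace (1 * 0 + -1) with (-1) by ring.
    replace (1 * t + -1) with (t - 1) by ring.
    apply (RInt_correct (V := R_CompleteNormedModule) g), Hex. }
assert (H0 : RInt g (-1) 0 = 0).
{ rewrite (RInt_ext g (fun _ => 0)).
  - rewrite RInt_const; unfold scal; simpl; unfold mult; simpl; ring.
  - intros s; rewrite Rmin_left, Rmax_right by lra; intros Hs; apply g_neg; lra. }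
assert (Hd := is_RInt_minus _ _ _ _ _ _
  (RInt_correct (V := R_CompleteNormedModule) g 0 t (Hex 0 t)) Hsh).
assert (E := is_RInt_unique _ _ _ _ (is_RInt_g_dde t Ht)).
apply is_RInt_unique in Hd.
assert (C1 := RInt_Chasles g (-1) 0 t (Hex _ _) (Hex _ _)).
assert (C2 := RInt_Chasles g (-1) (t - 1) t (Hex _ _) (Hex _ _)).
unfold minus, plus, opp in *; simpl in *.
change (RInt (fun s => g s + - g (s - 1)) 0 t
        = RInt g 0 t + - RInt g (-1) (t - 1)) in Hd.
change (RInt (fun s => g s + - g (s - 1)) 0 t = g t - 1) in E.
lra.
Qed.

Lemma ex_RInt_shift (f : R -> R) a x y :
  (forall u v, ex_RInt f u v) -> ex_RInt (fun s => f (s - a)) x y.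
Proof.
intros Hf; apply ex_RInt_ext with (fun s => scal 1 (f (1 * s + - a))).
- intros s _; rewrite (Rmult_1_l s); apply (scal_one (f (s + - a))).
- apply (ex_RInt_comp_lin (V := R_NormedModule) f 1 (- a)), Hf.
Qed.

Lemma is_RInt_g_shift_mean a t : a <= t ->
  is_RInt (fun s => g (s - a)) (t - 1) t (g (t - a) - 1).
Proof.
intros Ht; apply is_RInt_ext with (fun s => scal 1 (g (1 * s + - a))).
- intros s _; rewrite (Rmult_1_l s); apply (scal_one (g (s + - a))).
- apply (is_RInt_comp_lin (V := R_NormedModule) g 1 (- a)).
  replace (1 * (t - 1) + - a) with (t - a - 1) by ring.
  replace (1 * t + - a) with (t - a) by ring.
  apply is_RInt_g_mean; lra.
Qed.

(** * Positivity from a mean-value equation *)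

(** At its minimum a function cannot exceed its mean over the preceding unit
    interval by [k > 0] and be nonpositive: all the values averaged are at least
    the minimum, either by minimality or by nonnegativity on [(a, a + 1)]. *)
Lemma mean_renewal_pos (u : R -> R) a k :
  0 < k ->
  (forall x y, ex_RInt u x y) ->
  (forall t, a + 1 <= t -> is_RInt u (t - 1) t (u t - k)) ->
  (forall t, a < t < a + 1 -> 0 <= u t) ->
  forall t, a + 1 <= t -> 0 < u t.
Proof.
intros Hk Hex Hmean Hinit b Hb.
(* [u] itself may jump at [a + 1]; its integral expression [J] is continuous on
   the whole line and agrees with [u] from [a + 1] on, so it attains a minimum. *)
set (J := fun t => k + (RInt u a t - RInt u a (t - 1))).
assert (HJ : forall t, a + 1 <= t -> u t = J t).
{ intros t Ht; unfold J.
  assert (C := RInt_Chasles u a (t - 1) t (Hex _ _) (Hex _ _)).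
  assert (E := is_RInt_unique _ _ _ _ (Hmean t Ht)).
  unfold plus in C; simpl in C.
  change (RInt u (t - 1) t = u t - k) in E; lra. }
assert (HI : forall t, continuous (fun t => RInt u a t) t).
{ intros t; apply continuous_RInt_1 with (f := u) (a := a).
  apply filter_forall; intros z; apply (RInt_correct (V := R_CompleteNormedModule)), Hex. }
assert (HJc : forall t, continuity_pt J t).
{ intros t; apply continuity_pt_filterlim.
  apply (continuous_plus (V := R_NormedModule) (fun _ => k)
           (fun t => RInt u a t - RInt u a (t - 1)) t); [apply continuous_const|].
  apply (continuous_minus (V := R_NormedModule) (fun t => RInt u a t)
           (fun t => RInt u a (t - 1)) t); [apply HI|].
  apply (continuous_comp (fun t => t - 1) (fun t => RInt u a t)); [|apply HI].
  apply (continuous_minus (V := R_NormedModule));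
    [apply continuous_id|apply continuous_const]. }
destruct (continuity_ab_min J (a + 1) b Hb (fun c _ => HJc c)) as [m [Hm Hmb]].
destruct (Rlt_le_dec 0 (J m)) as [HP|HP].
{ rewrite HJ by lra; assert (H := Hm b ltac:(lra)); lra. }
exfalso.
assert (Hge : J m <= u m - k).
{ apply (is_RInt_le (fun _ => J m) u (m - 1) m); [lra| |apply Hmean; lra|].
  - generalize (is_RInt_const (V := R_NormedModule) (m - 1) m (J m)).
    change (scal (m - (m - 1)) (J m)) with ((m - (m - 1)) * J m).
    replace ((m - (m - 1)) * J m) with (J m) by ring; trivial.
  - intros x Hx; destruct (Rlt_le_dec x (a + 1)) as [H|H].
    + assert (H1 := Hinit x ltac:(lra)); lra.
    + rewrite (HJ x) by lra; apply Hm; lra. }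
rewrite HJ in Hge by lra; lra.
Qed.

Lemma is_RInt_lin a b t : is_RInt (fun s => a * s + b) (t - 1) t (a * (t - 1/2) + b).
Proof.
replace (a * (t - 1/2) + b)
  with (minus (a * t ^ 2 / 2 + b * t) (a * (t - 1) ^ 2 / 2 + b * (t - 1)))
  by (unfold minus, plus, opp; simpl; field).
apply (is_RInt_derive (V := R_CompleteNormedModule)
         (fun s => a * s ^ 2 / 2 + b * s) (fun s => a * s + b)).
- intros s _; auto_derive; trivial; field.
- intros s _; apply (ex_derive_continuous (fun s => a * s + b)); auto_derive; trivial.
Qed.

Lemma ex_RInt_lin a b x y : ex_RInt (fun s => a * s + b) x y.
Proof.
apply (ex_RInt_continuous (V := R_CompleteNormedModule)); intros s _.
apply (ex_derive_continuous (fun s => a * s + b)); auto_derive; trivial.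
Qed.

(** A linear function exceeds its mean over the preceding unit interval by half
    its slope, and [g] exceeds its own by [1].  Hence [g] minus a line of slope
    [2 - e] and a line of slope [2 + e] minus [g] both exceed their means by
    [e / 2]; the bound follows by letting [e] tend to [0]. *)
Lemma g_near_2t t : 0 <= t -> Rabs (g t - 2 * t) <= 3.
Proof.
intros Ht.
assert (Hunit : forall s, 0 <= s < 1 -> 0 < g s < 3).
{ intros s Hs; rewrite g_unit by lra; split; [apply exp_pos|].
  assert (H := exp_increasing s 1 ltac:(lra)); assert (H3 := exp_le_3); lra. }
assert (Heps : forall e, 0 < e -> Rabs (g t - 2 * t) <= 3 + e * t).
{ intros e He.
  destruct (Rlt_le_dec t 1) as [H1|H1].
  { assert (H := Hunit t ltac:(lra)); apply Rabs_le; nra. }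
  assert (Hlow : 0 < g t + ((- 2 + e) * t + 3)).
  { apply (mean_renewal_pos (fun s => g s + ((- 2 + e) * s + 3)) 0 (e / 2));
      [lra| | | |lra].
    - intros x y; apply (ex_RInt_plus (V := R_NormedModule));
        [apply ex_RInt_g|apply ex_RInt_lin].
    - intros s Hs.
      replace (g s + ((- 2 + e) * s + 3) - e / 2)
        with (plus (g s - 1) ((- 2 + e) * (s - 1 / 2) + 3))
        by (unfold plus; simpl; field).
      apply (is_RInt_plus (V := R_NormedModule));
        [apply is_RInt_g_mean; lra|apply is_RInt_lin].
    - intros s Hs; assert (H := Hunit s ltac:(lra)); nra. }
  assert (Hup : 0 < ((2 + e) * t + 3) - g t).
  { apply (mean_renewal_pos (fun s => ((2 + e) * s + 3) - g s) 0 (e / 2));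
      [lra| | | |lra].
    - intros x y; apply (ex_RInt_minus (V := R_NormedModule));
        [apply ex_RInt_lin|apply ex_RInt_g].
    - intros s Hs.
      replace ((2 + e) * s + 3 - g s - e / 2)
        with (minus ((2 + e) * (s - 1 / 2) + 3) (g s - 1))
        by (unfold minus, plus, opp; simpl; field).
      apply (is_RInt_minus (V := R_NormedModule));
        [apply is_RInt_lin|apply is_RInt_g_mean; lra].
    - intros s Hs; assert (H := Hunit s ltac:(lra)); nra. }
  apply Rabs_le; lra. }
apply le_epsilon; intros e He.
assert (Hp : 0 < e / (t + 1)) by (apply Rdiv_lt_0_compat; lra).
eapply Rle_trans; [apply (Heps _ Hp)|].
assert (e / (t + 1) * (t + 1) = e) by (field; lra); nra.
Qed.

Lemma is_lim_g_shift a : is_lim (fun t => g (t - a) / t) p_infty 2.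
Proof.
set (C := 3 + 2 * Rabs a).
assert (HC : forall k, is_lim (fun t => 2 + k * / t) p_infty 2).
{ intros k; replace (Finite 2) with (Finite (2 + k * 0)) by (f_equal; ring).
  apply is_lim_plus'; [apply is_lim_const|].
  apply (is_lim_scal_l (fun t => / t) k p_infty 0).
  apply (is_lim_inv (fun t => t) p_infty p_infty); [apply is_lim_id|discriminate]. }
apply is_lim_le_le_loc with (fun t => 2 + - C * / t) (fun t => 2 + C * / t);
  [|apply HC|apply HC].
exists (Rmax 1 a); intros t Ht.
assert (H1 := Rmax_l 1 a); assert (H2 := Rmax_r 1 a).
assert (Hb := g_near_2t (t - a) ltac:(lra)); apply Rabs_le_between in Hb.
assert (Ha := Rle_abs a); assert (Ha' := Rle_abs (- a)); rewrite Rabs_Ropp in Ha'.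
assert (Hi : 0 < / t) by (apply Rinv_0_lt_compat; lra).
assert (E : 2 = 2 * t * / t) by (field; lra).
unfold Rdiv; split.
- replace (2 + - C * / t) with ((2 * t - C) * / t) by (field; lra).
  apply Rmult_le_compat_r; unfold C; lra.
- replace (2 + C * / t) with ((2 * t + C) * / t) by (field; lra).
  apply Rmult_le_compat_r; unfold C; lra.
Qed.

(** * Taylor bounds, and functions of the form K (1 - cos t) + 1 + c sin t - exp (c t) *)

Lemma INR_fact_S n v w : INR (fact n) = v -> w = INR (S n) * v -> INR (fact (S n)) = w.
Proof. intros <- ->; rewrite fact_simpl, mult_INR; reflexivity. Qed.
Lemma small_factorials :
  INR (fact 0) = 1 /\ INR (fact 1) = 1 /\ INR (fact 2) = 2 /\ INR (fact 3) = 6 /\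
  INR (fact 4) = 24 /\ INR (fact 5) = 120 /\ INR (fact 6) = 720 /\
  INR (fact 7) = 5040 /\ INR (fact 8) = 40320 /\ INR (fact 9) = 362880.
Proof.
assert (F0 : INR (fact 0) = 1) by reflexivity.
assert (F1 : INR (fact 1) = 1) by (apply (INR_fact_S _ _ _ F0); simpl; lra).
assert (F2 : INR (fact 2) = 2) by (apply (INR_fact_S _ _ _ F1); simpl; lra).
assert (F3 : INR (fact 3) = 6) by (apply (INR_fact_S _ _ _ F2); simpl; lra).
assert (F4 : INR (fact 4) = 24) by (apply (INR_fact_S _ _ _ F3); simpl; lra).
assert (F5 : INR (fact 5) = 120) by (apply (INR_fact_S _ _ _ F4); simpl; lra).
assert (F6 : INR (fact 6) = 720) by (apply (INR_fact_S _ _ _ F5); simpl; lra).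
assert (F7 : INR (fact 7) = 5040) by (apply (INR_fact_S _ _ _ F6); simpl; lra).
assert (F8 : INR (fact 8) = 40320) by (apply (INR_fact_S _ _ _ F7); simpl; lra).
assert (F9 : INR (fact 9) = 362880) by (apply (INR_fact_S _ _ _ F8); simpl; lra).
auto 10.
Qed.

Lemma sin_taylor x : 0 <= x <= 3 ->
  x - x ^ 3 / 6 + x ^ 5 / 120 - x ^ 7 / 5040 <= sin x
  <= x - x ^ 3 / 6 + x ^ 5 / 120 - x ^ 7 / 5040 + x ^ 9 / 362880.
Proof.
intros Hx; assert (HP := PI2_3_2); unfold PI2 in HP.
destruct small_factorials as (F0 & F1 & F2 & F3 & F4 & F5 & F6 & F7 & F8 & F9).
destruct (sin_bound x 1 ltac:(lra) ltac:(lra)) as [H H'].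
pose (u := fun k : nat => (-1) ^ k).
pose (v := fun k : nat => x ^ k / INR (fact k)).
change (u 0%nat * v 1%nat + u 1%nat * v 3%nat + u 2%nat * v 5%nat + u 3%nat * v 7%nat
        <= sin x) in H.
change (sin x <= u 0%nat * v 1%nat + u 1%nat * v 3%nat + u 2%nat * v 5%nat
        + u 3%nat * v 7%nat + u 4%nat * v 9%nat) in H'.
assert (V1 : v 1%nat = x ^ 1 / 1) by (unfold v; now rewrite F1).
assert (V3 : v 3%nat = x ^ 3 / 6) by (unfold v; now rewrite F3).
assert (V5 : v 5%nat = x ^ 5 / 120) by (unfold v; now rewrite F5).
assert (V7 : v 7%nat = x ^ 7 / 5040) by (unfold v; now rewrite F7).
assert (V9 : v 9%nat = x ^ 9 / 362880) by (unfold v; now rewrite F9).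
rewrite V1, V3, V5, V7 in H; rewrite V1, V3, V5, V7, V9 in H'.
unfold u in H, H'; simpl in H, H' |- *; lra.
Qed.

Lemma cos_taylor x : 0 <= x <= 2 ->
  1 - x ^ 2 / 2 + x ^ 4 / 24 - x ^ 6 / 720 <= cos x
  <= 1 - x ^ 2 / 2 + x ^ 4 / 24 - x ^ 6 / 720 + x ^ 8 / 40320.
Proof.
intros Hx.
destruct small_factorials as (F0 & F1 & F2 & F3 & F4 & F5 & F6 & F7 & F8 & F9).
destruct (pre_cos_bound x 1 ltac:(lra) ltac:(lra)) as [H H'].
pose (u := fun k : nat => (-1) ^ k).
pose (v := fun k : nat => x ^ k / INR (fact k)).
change (u 0%nat * v 0%nat + u 1%nat * v 2%nat + u 2%nat * v 4%nat + u 3%nat * v 6%nat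
        <= cos x) in H.
change (cos x <= u 0%nat * v 0%nat + u 1%nat * v 2%nat + u 2%nat * v 4%nat
        + u 3%nat * v 6%nat + u 4%nat * v 8%nat) in H'.
assert (V0 : v 0%nat = x ^ 0 / 1) by (unfold v; now rewrite F0).
assert (V2 : v 2%nat = x ^ 2 / 2) by (unfold v; now rewrite F2).
assert (V4 : v 4%nat = x ^ 4 / 24) by (unfold v; now rewrite F4).
assert (V6 : v 6%nat = x ^ 6 / 720) by (unfold v; now rewrite F6).
assert (V8 : v 8%nat = x ^ 8 / 40320) by (unfold v; now rewrite F8).
rewrite V0, V2, V4, V6 in H; rewrite V0, V2, V4, V6, V8 in H'.
unfold u in H, H'; simpl in H, H' |- *; lra.
Qed.

(** Read off from [sin (PI / 6) = 1 / 2], where the Taylor polynomials are very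
    accurate. *)
Lemma PI_bounds : 3.1415 < PI < 3.1416.
Proof.
assert (HP := PI2_3_2); unfold PI2 in HP.
assert (H6 := sin_PI6).
split.
- destruct (Rlt_le_dec 3.1415 PI) as [H|H]; [exact H|exfalso].
  assert (Hs : sin (PI / 6) <= sin (3.1415 / 6)) by (apply sin_incr_1; lra).
  destruct (sin_taylor (3.1415 / 6) ltac:(lra)) as [_ H1]; lra.
- destruct (Rlt_le_dec PI 3.1416) as [H|H]; [exact H|exfalso].
  assert (Hs : sin (3.1416 / 6) <= sin (PI / 6)) by (apply sin_incr_1; lra).
  destruct (sin_taylor (3.1416 / 6) ltac:(lra)) as [H1 _]; lra.
Qed.

(** [sin x / x] decreases, because the slope of the sine decreases. *)
Lemma sin_ge_chord x y : 0 < x -> x <= y -> y <= PI / 2 -> x * sin y <= y * sin x.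
Proof.
intros Hx Hxy Hy; assert (HP := PI_RGT_0).
destruct (Req_dec x y) as [->|Hne]; [lra|].
destruct (MVT_cor2 sin cos 0 x Hx) as [u [Eu Hu]].
{ intros c _; apply derivable_pt_lim_sin. }
destruct (MVT_cor2 sin cos x y ltac:(lra)) as [v [Ev Hv]].
{ intros c _; apply derivable_pt_lim_sin. }
assert (Hc : cos v <= cos u) by (apply cos_decr_1; lra).
rewrite sin_0 in Eu.
replace (sin y) with (sin x + cos v * (y - x)) by lra.
replace (sin x) with (cos u * x) by lra.
assert (0 <= x * (y - x)) by nra.
nra.
Qed.

(** [1 - cos t = 2 sin^2 (t / 2)], and the sine is above its chord on
    [[0, PI / 2]].  Equality holds at [PI]. *)
Lemma one_minus_cos_ge t : 0 <= t <= PI -> 2 * (t / PI) ^ 2 <= 1 - cos t.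
Proof.
intros Ht; assert (HP := PI_RGT_0).
destruct (Req_dec t 0) as [->|Hne].
{ rewrite cos_0; unfold Rdiv; rewrite Rmult_0_l; lra. }
assert (H := sin_ge_chord (t / 2) (PI / 2) ltac:(lra) ltac:(lra) ltac:(lra)).
rewrite sin_PI2 in H.
assert (Hs : t / PI <= sin (t / 2)).
{ apply Rmult_le_reg_l with (PI / 2); [lra|].
  replace (PI / 2 * (t / PI)) with (t / 2) by (field; lra); lra. }
assert (H0 : 0 <= t / PI) by (apply Rdiv_le_0_compat; lra).
replace t with (2 * (t / 2)) at 2 by field.
rewrite cos_2a_sin; nra.
Qed.

(** The parabola is symmetric about [PI / 2], like the sine, so only the first half
    matters, and there [t - t^3 / 6] is already above it.  Equality holds at [PI]. *)
Lemma sin_ge_parabola t : 0 <= t <= PI -> t - t ^ 2 / PI <= sin t.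
Proof.
intros Ht; assert (HP := PI_RGT_0); destruct PI_bounds as [_ HP4].
assert (Hhalf : forall x, 0 <= x <= PI / 2 -> x - x ^ 2 / PI <= sin x).
{ clear t Ht; intros t Ht.
  assert (Hi : / 3.1416 <= / PI) by (apply Rinv_le_contravar; lra).
  destruct (sin_bound t 0 ltac:(lra) ltac:(lra)) as [H _].
  unfold sin_approx, sin_term in H; simpl in H.
  assert (t ^ 3 / 6 <= t ^ 2 / PI); [|simpl in *; lra].
  unfold Rdiv.
  replace (t ^ 3 * / 6) with (t ^ 2 * (t / 6)) by (simpl; field).
  apply Rmult_le_compat_l; [nra|].
  lra. }
destruct (Rle_lt_dec t (PI / 2)) as [H|H]; [apply Hhalf; lra|].
rewrite <- sin_PI_x.
replace (t - t ^ 2 / PI) with ((PI - t) - (PI - t) ^ 2 / PI) by (field; lra).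
apply Hhalf; lra.
Qed.

(** Convexity of the exponential, from the tangent lines at [t * v] evaluated at
    [0] and at [v]. *)
Lemma exp_convex t v : 0 <= t <= 1 -> exp (t * v) <= 1 - t + t * exp v.
Proof.
intros Ht; assert (He := exp_pos (t * v)).
assert (H1 := exp_ineq1_le ((1 - t) * v)); assert (H2 := exp_ineq1_le (- (t * v))).
replace (exp v) with (exp (t * v) * exp ((1 - t) * v))
  by (rewrite <- exp_plus; f_equal; ring).
assert (E : exp (t * v) * exp (- (t * v)) = 1)
  by (rewrite <- exp_plus, Rplus_opp_r; apply exp_0).
assert (exp (t * v) * (1 + - (t * v)) <= 1) by nra.
assert (t * (exp (t * v) * (1 + (1 - t) * v)) <= t * (exp (t * v) * exp ((1 - t) * v))).
{ apply Rmult_le_compat_l; [lra|]; apply Rmult_le_compat_l; lra. }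
assert ((1 - t) * (exp (t * v) * (1 + - (t * v))) <= (1 - t) * 1).
{ apply Rmult_le_compat_l; lra. }
lra.
Qed.

Lemma le_of_derivative_nonneg (f f' : R -> R) b :
  (forall x, 0 <= x <= b -> derivable_pt_lim f x (f' x)) ->
  (forall x, 0 <= x <= b -> 0 <= f' x) -> 0 <= b -> f 0 <= f b.
Proof.
intros Hd Hp Hb; destruct (Req_dec b 0) as [->|Hne]; [lra|].
destruct (MVT_cor2 f f' 0 b ltac:(lra) Hd) as [c [E Hc]].
assert (H := Hp c ltac:(lra)); nra.
Qed.

(** The remainder [exp v - 1 - v] divided by [v^2] increases for [v >= 0]. *)
Lemma exp_remainder_scaling t v : 0 <= t <= 1 -> 0 <= v ->
  exp (t * v) - 1 - t * v <= t ^ 2 * (exp v - 1 - v).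
Proof.
intros Ht Hv.
assert (H : t ^ 2 * (exp 0 - 1 - 0) - (exp (t * 0) - 1 - t * 0)
            <= t ^ 2 * (exp v - 1 - v) - (exp (t * v) - 1 - t * v)).
{ apply (le_of_derivative_nonneg
           (fun x => t ^ 2 * (exp x - 1 - x) - (exp (t * x) - 1 - t * x))
           (fun x => t * (1 - t + t * exp x - exp (t * x)))); [| |lra].
  - intros x _; apply is_derive_Reals; auto_derive; trivial; ring.
  - intros x _; assert (Hc := exp_convex t x Ht); nra. }
rewrite Rmult_0_r, exp_0 in H; lra.
Qed.

(** The sum of three comparisons that are all equalities at [t = PI]: the quotient
    by [t^2] is smallest at the right end of the interval. *)
Lemma trig_exp_lower_bound K c t : 0 <= K -> 0 <= c -> 0 <= t <= PI ->
  (t / PI) ^ 2 * (2 * K + 1 - exp (c * PI))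
  <= K * (1 - cos t) + 1 + c * sin t - exp (c * t).
Proof.
intros HK Hc Ht; assert (HP := PI_RGT_0).
assert (H1 := one_minus_cos_ge t Ht); assert (H2 := sin_ge_parabola t Ht).
assert (Hr : 0 <= t / PI <= 1).
{ split; [apply Rdiv_le_0_compat; lra|].
  apply Rmult_le_reg_r with PI; [lra|]; unfold Rdiv; rewrite Rmult_assoc, Rinv_l; lra. }
assert (H3 := exp_remainder_scaling (t / PI) (c * PI) Hr ltac:(nra)).
replace (t / PI * (c * PI)) with (c * t) in H3 by (field; lra).
assert (H4 : c * (t - t ^ 2 / PI) <= c * sin t) by (apply Rmult_le_compat_l; lra).
assert (H5 : K * (2 * (t / PI) ^ 2) <= K * (1 - cos t)) by (apply Rmult_le_compat_l; lra).
replace (c * (t - t ^ 2 / PI)) with (c * t - (t / PI) ^ 2 * (c * PI)) in H4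
  by (field; lra).
lra.
Qed.

Lemma exp_ge_quadratic x : 0 <= x -> 1 + x + x ^ 2 / 2 <= exp x.
Proof.
intros Hx; assert (H := exp_ge_taylor x 2 Hx); simpl in H |- *; lra.
Qed.

Lemma one_minus_cos_le_quadratic t : 0 <= t <= PI -> 1 - cos t <= t ^ 2 / 2.
Proof.
intros Ht.
replace t with (2 * (t / 2)) at 1 by field; rewrite cos_2a_sin.
assert (H0 : 0 <= sin (t / 2)) by (apply sin_ge_0; lra).
assert (H1 : sin (t / 2) <= t / 2).
{ destruct (Req_dec t 0) as [->|Hne]; [unfold Rdiv; rewrite Rmult_0_l, sin_0; lra|].
  apply Rlt_le, sin_lt_x; lra. }
nra.
Qed.

(** The second-order Taylor polynomial at [0] of each part errs in the right
    direction, so that the quotient by [t^2] is at most its limit at [0]. *)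
Lemma trig_exp_upper_bound K c t : 0 <= K -> 0 <= c -> 0 <= t <= PI ->
  K * (1 - cos t) + 1 + c * sin t - exp (c * t) <= t ^ 2 * ((K - c ^ 2) / 2).
Proof.
intros HK Hc Ht.
assert (H1 := one_minus_cos_le_quadratic t Ht).
assert (H2 : sin t <= t).
{ destruct (Req_dec t 0) as [->|Hne]; [rewrite sin_0; lra|].
  apply Rlt_le, sin_lt_x; lra. }
assert (H3 := exp_ge_quadratic (c * t) ltac:(nra)).
assert (K * (1 - cos t) <= K * (t ^ 2 / 2)) by (apply Rmult_le_compat_l; lra).
assert (c * sin t <= c * t) by (apply Rmult_le_compat_l; lra).
replace (t ^ 2 * ((K - c ^ 2) / 2)) with (K * (t ^ 2 / 2) - (c * t) ^ 2 / 2)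
  by (simpl; field).
lra.
Qed.

(** * Numerical bounds on the angle *)

(** An upper bound for the exponential, in the form of a cubic lower bound for
    [exp (- x)]: the derivative of the left side is [- exp x * x^3 / 6]. *)
Lemma exp_le_inv_cubic x : 0 <= x -> exp x * (1 - x + x ^ 2 / 2 - x ^ 3 / 6) <= 1.
Proof.
intros Hx.
assert (H : - (exp 0 * (1 - 0 + 0 ^ 2 / 2 - 0 ^ 3 / 6))
            <= - (exp x * (1 - x + x ^ 2 / 2 - x ^ 3 / 6))).
{ apply (le_of_derivative_nonneg
           (fun y => - (exp y * (1 - y + y ^ 2 / 2 - y ^ 3 / 6)))
           (fun y => exp y * (y ^ 3 / 6))); [| |lra].
  - intros y _; apply is_derive_Reals; auto_derive; trivial; field.
  - intros y Hy; assert (He := exp_pos y).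
    assert (H3 : 0 <= y ^ 3) by (apply pow_le; lra); nra. }
rewrite exp_0 in H; lra.
Qed.

Lemma exp_nat_mul n x : exp (INR n * x) = exp x ^ n.
Proof.
induction n as [|n IH]; [simpl; rewrite Rmult_0_l; apply exp_0|].
rewrite S_INR, Rmult_plus_distr_r, Rmult_1_l, exp_plus, IH; simpl; ring.
Qed.

(** The left side of the equation that defines the angle. *)
Definition bar_alpha_gap (a : R) : R :=
  (2 * PI + a) * cot a - ln ((2 * PI + a) / sin a).

Lemma bar_alpha_gap_decreasing a b : 0 < a -> a < b -> b < PI / 2 ->
  bar_alpha_gap b < bar_alpha_gap a.
Proof.
intros Ha Hab Hb; assert (HPI := PI_bounds).
set (d := fun x => - ((2 * PI + x - 2 * (sin x * cos x)) / (sin x) ^ 2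
                      + / (2 * PI + x))).
destruct (MVT_cor2 bar_alpha_gap d a b Hab) as [x [E Hx]].
- intros x Hx; apply is_derive_Reals.
  assert (Hs : 0 < sin x) by (apply sin_gt_0; lra).
  unfold bar_alpha_gap, d, cot; auto_derive.
  + repeat split; try lra; apply Rdiv_lt_0_compat; lra.
  + assert (H := sin2_cos2 x); unfold Rsqr in H.
    replace (2 * PI + x - 2 * (sin x * cos x))
      with ((2 * PI + x) * (sin x * sin x + cos x * cos x) - 2 * (sin x * cos x))
      by (rewrite H; ring).
    field; lra.
- assert (Hs : 0 < sin x) by (apply sin_gt_0; lra).
  assert (Hb1 := SIN_bound x); assert (Hb2 := COS_bound x).
  assert (0 < (2 * PI + x - 2 * (sin x * cos x)) / (sin x) ^ 2).
  { apply Rdiv_lt_0_compat; [nra|apply pow_lt; lra]. }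
  assert (0 < / (2 * PI + x)) by (apply Rinv_0_lt_compat; lra).
  assert (d x < 0) by (unfold d; lra).
  assert (d x * (b - a) < 0) by nra; lra.
Qed.

Lemma trig_at_1178 : 0.92383 < sin 1.178 < 0.92386 /\ 0.38268 < cos 1.178 < 0.3828.
Proof.
destruct (sin_taylor 1.178 ltac:(lra)); destruct (cos_taylor 1.178 ltac:(lra)).
lra.
Qed.

Lemma trig_at_1179 : 0.9242 < sin 1.179 < 0.92423 /\ 0.38175 < cos 1.179 < 0.38186.
Proof.
destruct (sin_taylor 1.179 ltac:(lra)); destruct (cos_taylor 1.179 ltac:(lra)).
lra.
Qed.

Lemma bar_alpha_gap_at_1178 : 1 < bar_alpha_gap 1.178.
Proof.
destruct trig_at_1178 as [Hs Hc]; assert (HPI := PI_bounds).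
unfold bar_alpha_gap, cot.
assert (Hq : 0.4142 < cos 1.178 / sin 1.178).
{ apply Rmult_lt_reg_r with (sin 1.178); [lra|].
  unfold Rdiv; rewrite Rmult_assoc, Rinv_l; lra. }
assert (HL : (2 * PI + 1.178) / sin 1.178 < 8.0766).
{ apply Rmult_lt_reg_r with (sin 1.178); [lra|].
  unfold Rdiv; rewrite Rmult_assoc, Rinv_l; lra. }
assert (He : 8.0766 < exp 2.09).
{ replace 2.09 with (INR 4 * 0.5225) by (simpl; lra).
  rewrite exp_nat_mul.
  assert (H := exp_ge_taylor 0.5225 5 ltac:(lra)); simpl in H.
  assert (H1 : 1.6861 < exp 0.5225) by lra.
  assert (H2 : 2.8429 < exp 0.5225 * exp 0.5225) by nra.
  simpl; nra. }
assert (Hln : ln ((2 * PI + 1.178) / sin 1.178) < 2.09).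
{ rewrite <- (ln_exp 2.09); apply ln_increasing; [|lra].
  apply Rdiv_lt_0_compat; lra. }
nra.
Qed.

Lemma bar_alpha_gap_at_1179 : bar_alpha_gap 1.179 < 1.
Proof.
destruct trig_at_1179 as [Hs Hc]; assert (HPI := PI_bounds).
unfold bar_alpha_gap, cot.
assert (Hq : cos 1.179 / sin 1.179 < 0.4132).
{ apply Rmult_lt_reg_r with (sin 1.179); [lra|].
  unfold Rdiv; rewrite Rmult_assoc, Rinv_l; lra. }
assert (HL : 8.071 < (2 * PI + 1.179) / sin 1.179).
{ apply Rmult_lt_reg_r with (sin 1.179); [lra|].
  unfold Rdiv; rewrite Rmult_assoc, Rinv_l; lra. }
assert (He : exp 2.0836 < 8.071).
{ replace 2.0836 with (INR 8 * 0.26045) by (simpl; lra).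
  rewrite exp_nat_mul.
  assert (H := exp_le_inv_cubic 0.26045 ltac:(lra)).
  assert (Hp := exp_pos 0.26045).
  assert (H1 : exp 0.26045 < 1.29783) by nra.
  assert (H2 : 0 < exp 0.26045 * exp 0.26045 < 1.68437) by nra.
  assert (H4 : 0 < (exp 0.26045 * exp 0.26045) * (exp 0.26045 * exp 0.26045) < 2.8372)
    by nra.
  simpl; nra. }
assert (Hln : 2.0836 < ln ((2 * PI + 1.179) / sin 1.179)).
{ rewrite <- (ln_exp 2.0836); apply ln_increasing; [apply exp_pos|lra]. }
nra.
Qed.

(** The bounds on the total mass leave a margin of less than one percent near
    [theta = 0] and of two percent at [theta = PI], which is why the angle is needed
    to three decimals. *)
Lemma bar_alpha_bounds a : is_bar_alpha a -> 1.178 < a < 1.179.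
Proof.
intros [Ha E]; fold (bar_alpha_gap a) in E.
assert (HPI := PI_bounds).
assert (H1 := bar_alpha_gap_at_1178); assert (H2 := bar_alpha_gap_at_1179).
split.
- destruct (Rtotal_order 1.178 a) as [H|[H|H]]; [exact H|subst; lra|].
  assert (H' := bar_alpha_gap_decreasing a 1.178 ltac:(lra) H ltac:(lra)); lra.
- destruct (Rtotal_order a 1.179) as [H|[H|H]]; [exact H|subst; lra|].
  assert (H' := bar_alpha_gap_decreasing 1.179 a ltac:(lra) H ltac:(lra)); lra.
Qed.

Lemma bar_alpha_numerics a : is_bar_alpha a ->
  7.461 < 2 * PI + a < 7.4622 /\ 0.92383 < sin a < 0.92423 /\
  0.38175 < cos a < 0.3828 /\ 0.41304 < cot a < 0.4144 /\
  0.279 < bar_c a < 0.2804.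
Proof.
intros Ha; assert (Hb := bar_alpha_bounds a Ha); assert (HPI := PI_bounds).
destruct trig_at_1178 as [Hs1 Hc1]; destruct trig_at_1179 as [Hs2 Hc2].
assert (Hs : 0.92383 < sin a < 0.92423).
{ assert (sin 1.178 < sin a) by (apply sin_increasing_1; lra).
  assert (sin a < sin 1.179) by (apply sin_increasing_1; lra); lra. }
assert (Hc : 0.38175 < cos a < 0.3828).
{ assert (cos a < cos 1.178) by (apply cos_decreasing_1; lra).
  assert (cos 1.179 < cos a) by (apply cos_decreasing_1; lra); lra. }
assert (Hq : 0.41304 < cot a < 0.4144).
{ unfold cot.
  assert (E : cos a / sin a * sin a = cos a) by (field; lra).
  split; nra. }
split; [lra|]; split; [lra|]; split; [lra|]; split; [lra|].
unfold bar_c.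
assert (Hi : 0.134 < / (2 * PI + a) < 0.13404).
{ assert (E : / (2 * PI + a) * (2 * PI + a) = 1) by (field; lra).
  assert (Hp : 0 < / (2 * PI + a)) by (apply Rinv_0_lt_compat; lra).
  split; nra. }
unfold Rdiv; lra.
Qed.

(** * The sources as functions of theta *)

(** Used to express all the sources as [sin a / (2 PI + a)] times a polynomial
    in [cot a]. *)
Lemma inv_sin_cot a : sin a <> 0 -> / sin a = sin a * (1 + cot a ^ 2).
Proof.
intros Hs; unfold cot; assert (H := sin2_cos2 a); unfold Rsqr in H.
replace (sin a * (1 + (cos a / sin a) ^ 2))
  with ((sin a * sin a + cos a * cos a) / sin a) by (field; exact Hs).
rewrite H; unfold Rdiv; ring.
Qed.

Lemma cos_shift_minus_cos a t : sin a <> 0 ->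
  cos (a - t) - cos a = sin a * (sin t - cot a * (1 - cos t)).
Proof. intros Hs; rewrite cos_minus; unfold cot; field; exact Hs. Qed.

(** The coefficient of [1 - cos t] in [total_mass]. *)
Definition mass_coef (a : R) : R :=
  bar_c a * ((2 * PI + a) * (1 + cot a ^ 2) - cot a).

(** With [cos (a - t) - cos a] rewritten, every source carries the factor [sin a];
    the terms of order [0] and [1] in [t] cancel because [bar_c a] is both the
    growth rate in [S1] and the total coefficient of [sin t]. *)
Lemma total_mass a t : 0 < 2 * PI + a -> sin a <> 0 ->
  S0 a t + S1 a t + S2 a t + S3 a t
  = sin a / (2 * PI + a)
    * (mass_coef a * (1 - cos t) + 1 + bar_c a * sin t - exp (bar_c a * t)).
Proof.
intros HL Hs; unfold S0, S1, S2, S3, mass_coef.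
rewrite !cos_shift_minus_cos by exact Hs.
set (E := exp (bar_c a * t)); unfold bar_c.
unfold Rdiv at 1 4; rewrite Rinv_mult, (inv_sin_cot a Hs).
field; lra.
Qed.

(** The coefficient of [1 - cos t] in [second_turn_value]. *)
Definition second_turn_coef (a : R) : R :=
  (exp 1 - 1) * ((2 * PI + a) * cot a * (1 + cot a ^ 2)) - (1 + 2 * cot a ^ 2).

(** The left side is the value that [exp (1 - tau) * rho_reg] would approach as
    [tau] tends to [2] if the correction to the exponential in the kernel shifted by
    [tau1] were neglected. *)
Lemma second_turn_value a t : 0 < 2 * PI + a -> sin a <> 0 ->
  S0 a t * (exp 1 - 1) + S1 a t * exp (t / (2 * PI + a)) + S2 a t
  = sin a / (2 * PI + a)
    * (second_turn_coef a * (1 - cos t) + 1 + cot a * sin t - exp (cot a * t)).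
Proof.
intros HL Hs; unfold S0, S1, S2, second_turn_coef.
rewrite !cos_shift_minus_cos by exact Hs.
replace (exp (cot a * t)) with (exp (bar_c a * t) * exp (t / (2 * PI + a)))
  by (rewrite <- exp_plus; f_equal; unfold bar_c; field; lra).
generalize (exp 1) (exp (bar_c a * t)) (exp (t / (2 * PI + a))); intros e E F.
unfold Rdiv at 1 4; rewrite Rinv_mult, (inv_sin_cot a Hs).
field; lra.
Qed.

Lemma S0_pos a t : is_bar_alpha a -> 0 < t <= PI -> 0 < S0 a t.
Proof.
intros Ha Ht; destruct (bar_alpha_numerics a Ha) as (_ & Hs & _ & Hq & _).
unfold S0; apply Rmult_lt_0_compat; [lra|]; apply Rdiv_lt_0_compat; [|lra].
assert (H := cos_decreasing_1 0 t); rewrite cos_0 in H.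
assert (cos t < 1) by (apply H; lra); lra.
Qed.

Lemma S1_neg a t : is_bar_alpha a -> S1 a t < 0.
Proof.
intros Ha; destruct (bar_alpha_numerics a Ha) as (HL & Hs & _).
unfold S1; assert (He := exp_pos (bar_c a * t)).
assert (0 < sin a / (2 * PI + a)) by (apply Rdiv_lt_0_compat; lra); nra.
Qed.

Lemma mass_coef_bounds a : is_bar_alpha a -> 2.321 < mass_coef a < 2.336.
Proof.
intros Ha; destruct (bar_alpha_numerics a Ha) as (HL & _ & _ & Hq & Hc).
unfold mass_coef.
assert (H2 : 1.1706 < 1 + cot a ^ 2 < 1.17173) by nra.
assert (H3 : 8.7338 < (2 * PI + a) * (1 + cot a ^ 2) < 8.7437) by nra.
nra.
Qed.

Lemma mass_lower a t : is_bar_alpha a -> 0 < t <= PI ->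
  t ^ 2 * 0.08 < 2 * (S0 a t + S1 a t + S2 a t + S3 a t).
Proof.
intros Ha Ht; destruct (bar_alpha_numerics a Ha) as (HL & Hs & _ & _ & Hc).
assert (HK := mass_coef_bounds a Ha); assert (HPI := PI_bounds).
rewrite total_mass by lra.
assert (H := trig_exp_lower_bound (mass_coef a) (bar_c a) t
               ltac:(lra) ltac:(lra) ltac:(lra)).
assert (He : exp (bar_c a * PI) < 2.415).
{ apply Rlt_trans with (exp (INR 4 * 0.22023)).
  - apply exp_increasing; simpl; nra.
  - rewrite exp_nat_mul.
    assert (H1 := exp_le_inv_cubic 0.22023 ltac:(lra)).
    assert (Hp := exp_pos 0.22023).
    assert (H2 : exp 0.22023 < 1.24656) by nra.
    assert (H3 : 0 < exp 0.22023 * exp 0.22023 < 1.55392) by nra.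
    simpl; nra. }
set (f := mass_coef a * (1 - cos t) + 1 + bar_c a * sin t - exp (bar_c a * t)) in *.
set (m := 2 * mass_coef a + 1 - exp (bar_c a * PI)) in *.
assert (Hm : 3.22 < m) by (unfold m; lra).
assert (Hsl : 0.1238 < sin a / (2 * PI + a)).
{ apply Rmult_lt_reg_r with (2 * PI + a); [lra|].
  unfold Rdiv; rewrite Rmult_assoc, Rinv_l; lra. }
assert (Hr : 0.325 * t ^ 2 < (t / PI) ^ 2 * m).
{ replace ((t / PI) ^ 2 * m) with (t ^ 2 * (m / PI ^ 2)) by (field; lra).
  rewrite (Rmult_comm 0.325); apply Rmult_lt_compat_l; [nra|].
  apply Rmult_lt_reg_r with (PI ^ 2); [nra|].
  unfold Rdiv; rewrite Rmult_assoc, Rinv_l; nra. }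
assert (Ht2 : 0 < t ^ 2) by nra.
assert (Hf : 0.325 * t ^ 2 < f) by lra.
assert (0.1238 * f < sin a / (2 * PI + a) * f) by (apply Rmult_lt_compat_r; nra).
lra.
Qed.

Lemma mass_upper a t : is_bar_alpha a -> 0 < t <= PI ->
  2 * (S0 a t + S1 a t + S2 a t + S3 a t) < t ^ 2 * 0.28.
Proof.
intros Ha Ht; destruct (bar_alpha_numerics a Ha) as (HL & Hs & _ & _ & Hc).
assert (HK := mass_coef_bounds a Ha).
rewrite total_mass by lra.
assert (H := trig_exp_upper_bound (mass_coef a) (bar_c a) t
               ltac:(lra) ltac:(lra) ltac:(lra)).
set (f := mass_coef a * (1 - cos t) + 1 + bar_c a * sin t - exp (bar_c a * t)) in *.
assert (Ht2 : 0 < t ^ 2) by nra.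
assert (Hf : f < 1.1292 * t ^ 2).
{ assert ((mass_coef a - bar_c a ^ 2) / 2 < 1.1292) by nra; nra. }
assert (Hsl : 0 < sin a / (2 * PI + a) < 0.12388).
{ split; [apply Rdiv_lt_0_compat; lra|].
  apply Rmult_lt_reg_r with (2 * PI + a); [lra|].
  unfold Rdiv; rewrite Rmult_assoc, Rinv_l; lra. }
assert (sin a / (2 * PI + a) * f <= sin a / (2 * PI + a) * (1.1292 * t ^ 2))
  by (apply Rmult_le_compat_l; lra).
nra.
Qed.

Lemma second_turn_pos a t : is_bar_alpha a -> 0 < t <= PI ->
  0 < S0 a t * (exp 1 - 1) + S1 a t * exp (t / (2 * PI + a)) + S2 a t.
Proof.
intros Ha Ht; destruct (bar_alpha_numerics a Ha) as (HL & Hs & _ & Hq & _).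
assert (HPI := PI_bounds).
rewrite second_turn_value by lra.
assert (Hsl : 0 < sin a / (2 * PI + a)) by (apply Rdiv_lt_0_compat; lra).
apply Rmult_lt_0_compat; [exact Hsl|].
assert (He : 2.5 <= exp 1) by (assert (H := exp_ge_quadratic 1); lra).
assert (HK : 4.02 < second_turn_coef a).
{ unfold second_turn_coef.
  assert (H2 : 1.17 < 1 + cot a ^ 2 < 1.1725) by nra.
  assert (H3 : 3.08 < (2 * PI + a) * cot a) by nra.
  assert (H4 : 3.6 < (2 * PI + a) * cot a * (1 + cot a ^ 2)) by nra.
  nra. }
assert (H := trig_exp_lower_bound (second_turn_coef a) (cot a) t
               ltac:(lra) ltac:(lra) ltac:(lra)).
assert (He2 : exp (cot a * PI) < 9).
{ apply Rlt_le_trans with (exp (1 + 1)); [apply exp_increasing; nra|].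
  assert (H3 := exp_le_3); rewrite exp_plus; nra. }
assert (0 < (t / PI) ^ 2 * (2 * second_turn_coef a + 1 - exp (cot a * PI))).
{ apply Rmult_lt_0_compat; [apply pow_lt, Rdiv_lt_0_compat; lra|lra]. }
lra.
Qed.

(** * Positivity of the density *)

(** The correction to the exponential in [g (tau - tau1)] comes with the
    nonpositive factor [S1] and helps, while the one in [g tau], which comes
    with [S0 > 0], is worst at [tau = 2]. *)
Lemma rho_reg_pos_second_turn a tau t : is_bar_alpha a -> 0 < t <= PI ->
  1 < tau < 2 -> 0 < rho_reg a tau t.
Proof.
intros Ha Ht Htau; destruct (bar_alpha_numerics a Ha) as (HL & _).
assert (HPI := PI_bounds).
assert (Hpos := second_turn_pos a t Ha Ht).
assert (H0 := S0_pos a t Ha Ht); assert (H1 := S1_neg a t Ha).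
assert (Hr : 0 < t / (2 * PI + a) < 1 / 2).
{ split; [apply Rdiv_lt_0_compat; lra|].
  apply Rmult_lt_reg_r with (2 * PI + a); [lra|].
  unfold Rdiv; rewrite Rmult_assoc, Rinv_l; lra. }
unfold rho_reg, tau1.
rewrite (g_neg (tau - 2)), (g_unit (tau - 1)), (g_second tau) by lra.
set (r := t / (2 * PI + a)) in *.
assert (Hg := g_le_exp (tau - (1 - r)) ltac:(lra)).
replace (exp (tau - (1 - r))) with (exp (tau - 1) * exp r) in Hg
  by (rewrite <- exp_plus; f_equal; ring).
replace (exp tau) with (exp (tau - 1) * exp 1)
  by (rewrite <- exp_plus; f_equal; ring).
assert (He := exp_pos (tau - 1)); set (e := exp (tau - 1)) in *.
assert (S1 a t * (e * exp r) <= S1 a t * g (tau - (1 - r))).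
{ apply Rmult_le_compat_neg_l; lra. }
assert (0 < e * (S0 a t * (exp 1 - 1) + S1 a t * exp r + S2 a t))
  by (apply Rmult_lt_0_compat; lra).
assert (0 <= e * (S0 a t * (2 - tau))) by (apply Rmult_le_pos; nra).
nra.
Qed.

Lemma ex_RInt_rho_reg a t x y : ex_RInt (fun tau => rho_reg a tau t) x y.
Proof.
assert (H : forall k b, ex_RInt (fun tau => k * g (tau - b)) x y).
{ intros k b; apply (ex_RInt_scal (V := R_NormedModule) (fun tau => g (tau - b))).
  apply ex_RInt_shift, ex_RInt_g. }
unfold rho_reg; do 3 (apply (ex_RInt_plus (V := R_NormedModule)); [|apply H]).
apply (ex_RInt_scal (V := R_NormedModule) g), ex_RInt_g.
Qed.

Lemma is_RInt_rho_reg_mean a t tau : 2 <= tau -> tau1 a t <= 2 ->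
  is_RInt (fun s => rho_reg a s t) (tau - 1) tau
    (rho_reg a tau t - (S0 a t + S1 a t + S2 a t + S3 a t)).
Proof.
intros Htau Ht1; unfold rho_reg.
replace (S0 a t * g tau + S1 a t * g (tau - tau1 a t) + S2 a t * g (tau - 1) +
         S3 a t * g (tau - 2) - (S0 a t + S1 a t + S2 a t + S3 a t))
  with (S0 a t * (g tau - 1) + S1 a t * (g (tau - tau1 a t) - 1)
        + S2 a t * (g (tau - 1) - 1) + S3 a t * (g (tau - 2) - 1)) by ring.
assert (H : forall k b, b <= tau ->
  is_RInt (fun s => k * g (s - b)) (tau - 1) tau (k * (g (tau - b) - 1))).
{ intros k b Hb; apply (is_RInt_scal (V := R_NormedModule) (fun s => g (s - b))).
  now apply is_RInt_g_shift_mean. }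
do 3 (apply (is_RInt_plus (V := R_NormedModule)); [|apply H; lra]).
apply (is_RInt_scal (V := R_NormedModule) g), is_RInt_g_mean; lra.
Qed.

(** Although [S3] can be negative and [rho_reg] then jumps down at [tau = 2],
    the mean-value equation holds from [tau = 2] on, jump included. *)
Lemma rho_reg_pos_after_second_turn a tau t : is_bar_alpha a -> 0 < t <= PI ->
  2 <= tau -> 0 < rho_reg a tau t.
Proof.
intros Ha Ht Htau.
destruct (bar_alpha_numerics a Ha) as (HL & _).
assert (Hm := mass_lower a t Ha Ht).
apply (mean_renewal_pos (fun s => rho_reg a s t) 1
         (S0 a t + S1 a t + S2 a t + S3 a t)).
- assert (0 < t ^ 2) by nra; lra.
- intros x y; apply ex_RInt_rho_reg.
- intros s Hs; apply is_RInt_rho_reg_mean; [lra|].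
  unfold tau1; assert (0 < t / (2 * PI + a)) by (apply Rdiv_lt_0_compat; lra); lra.
- intros s Hs; apply Rlt_le, rho_reg_pos_second_turn; [exact Ha|exact Ht|lra].
- lra.
Qed.

(** The sign of [cos (a - t) - cos a] governs both the Dirac mass and the
    monotonicity that makes [hat_theta] unique. *)
Lemma cos_shift_gt a t : 0 < a < PI / 2 -> 0 < t < 2 * a -> cos a < cos (a - t).
Proof.
intros Ha Ht; destruct (Rle_lt_dec t a) as [H|H].
- apply cos_decreasing_1; lra.
- replace (a - t) with (- (t - a)) by ring; rewrite cos_neg.
  apply cos_decreasing_1; lra.
Qed.

Lemma cos_shift_le a t : 0 < a < PI / 2 -> 2 * a <= t <= PI -> cos (a - t) <= cos a.
Proof.
intros Ha Ht; replace (a - t) with (- (t - a)) by ring; rewrite cos_neg.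
apply cos_decr_1; lra.
Qed.

(** The equation for [hat_theta] with its dependence on [t] collected on one
    side; the other side is the constant [exp (- cot a * (2 PI + a))]. *)
Definition damped_chord (a t : R) : R :=
  cot a * ((1 - cos t) / sin a) * exp (- cot a * t).

Lemma hat_theta_factor a t :
  cot a * ((1 - cos t) / sin a) - exp (- cot a * (2 * PI + a - t))
  = exp (cot a * t) * (damped_chord a t - exp (- cot a * (2 * PI + a))).
Proof.
replace (exp (- cot a * (2 * PI + a - t)))
  with (exp (cot a * t) * exp (- cot a * (2 * PI + a)))
  by (rewrite <- exp_plus; f_equal; ring).
assert (E : exp (cot a * t) * exp (- cot a * t) = 1).
{ rewrite <- exp_plus, <- exp_0; f_equal; ring. }
unfold damped_chord; rewrite Rmult_minus_distr_l.
replace (exp (cot a * t) * (cot a * ((1 - cos t) / sin a) * exp (- cot a * t)))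
  with (cot a * ((1 - cos t) / sin a) * (exp (cot a * t) * exp (- cot a * t))) by ring.
rewrite E; ring.
Qed.

Lemma derivable_damped_chord a t : sin a <> 0 ->
  derivable_pt_lim (damped_chord a) t
    (cot a / sin a ^ 2 * exp (- cot a * t) * (cos (a - t) - cos a)).
Proof.
intros Hs; rewrite cos_shift_minus_cos by exact Hs.
apply is_derive_Reals; unfold damped_chord.
auto_derive; trivial; field; exact Hs.
Qed.

(** [damped_chord] starts at [0], increases on [[0, 2 a]] and decreases on
    [[2 a, PI]] to a value above the threshold, so it crosses the threshold exactly
    once, upwards. *)
Lemma hat_theta_spec a : is_bar_alpha a ->
  exists h, unique (is_hat_theta a) h /\
    forall t, h < t <= PI ->
      exp (- cot a * (2 * PI + a - t)) < cot a * ((1 - cos t) / sin a).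
Proof.
intros Ha; destruct (bar_alpha_numerics a Ha) as (HL & Hs & _ & Hq & _).
assert (HPI := PI_bounds); assert (Ha' := proj1 Ha).
set (F := damped_chord a); set (m := exp (- cot a * (2 * PI + a))).
set (dF := fun t => cot a / sin a ^ 2 * exp (- cot a * t) * (cos (a - t) - cos a)).
assert (HdF : forall t, derivable_pt_lim F t (dF t))
  by (intros t; apply derivable_damped_chord; lra).
assert (Hw : forall t, 0 < cot a / sin a ^ 2 * exp (- cot a * t)).
{ intros t; apply Rmult_lt_0_compat; [|apply exp_pos].
  apply Rdiv_lt_0_compat; [lra|apply pow_lt; lra]. }
assert (Hinc : forall x y, 0 <= x -> x < y -> y <= 2 * a -> F x < F y).
{ intros x y Hx Hxy Hy.
  destruct (MVT_cor2 F dF x y Hxy (fun c _ => HdF c)) as [c [E Hc]].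
  assert (H := cos_shift_gt a c Ha' ltac:(lra)).
  assert (0 < dF c) by (apply Rmult_lt_0_compat; [apply Hw|lra]); nra. }
assert (Hdec : forall x, 2 * a <= x <= PI -> F PI <= F x).
{ intros x Hx; destruct (Req_dec x PI) as [->|Hne]; [lra|].
  destruct (MVT_cor2 F dF x PI ltac:(lra) (fun c _ => HdF c)) as [c [E Hc]].
  assert (H := cos_shift_le a c Ha' ltac:(lra)); assert (Hwc := Hw c).
  assert (dF c <= 0) by (unfold dF; nra); nra. }
assert (HFPI : m < F PI).
{ assert (H : 0 < exp (cot a * PI) * (F PI - m)).
  { unfold F, m; rewrite <- hat_theta_factor, cos_PI.
    assert (exp (- cot a * (2 * PI + a - PI)) < 0.8).
    { apply Rlt_trans with (exp (- (1))); [apply exp_increasing; nra|].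
      assert (E : exp 1 * exp (- (1)) = 1) by (rewrite <- exp_plus, <- exp_0; f_equal; ring).
      assert (H := exp_ge_quadratic 1 ltac:(lra)); assert (Hp := exp_pos (- (1))); nra. }
    assert (0.8 < cot a * ((1 - -1) / sin a)); [|lra].
    apply Rmult_lt_reg_r with (sin a); [lra|].
    replace (cot a * ((1 - -1) / sin a) * sin a) with (2 * cot a) by (field; lra).
    lra. }
  assert (Hp := exp_pos (cot a * PI)); nra. }
assert (HF0 : F 0 < m).
{ unfold F, damped_chord; rewrite cos_0, Rminus_diag; unfold Rdiv.
  rewrite Rmult_0_l, Rmult_0_r, Rmult_0_l; apply exp_pos. }
assert (HF2 : m < F (2 * a)) by (assert (H := Hdec (2 * a) ltac:(lra)); lra).
destruct (IVT_cor (fun t => F t - m) 0 (2 * a)) as [h [Hh Eh]].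
{ intros t; apply continuity_pt_minus.
  - apply derivable_continuous_pt; exists (dF t); apply HdF.
  - apply continuity_pt_const; intros x y; reflexivity. }
{ lra. }
{ nra. }
assert (Hh2 : h < 2 * a).
{ destruct (Req_dec h (2 * a)) as [->|Hne]; lra. }
assert (Habove : forall t, h < t <= PI -> m < F t).
{ intros t Ht; destruct (Rle_lt_dec t (2 * a)) as [H|H].
  - assert (H' := Hinc h t ltac:(lra) ltac:(lra) H); lra.
  - assert (H' := Hdec t ltac:(lra)); lra. }
exists h; split; [split|].
- split; [lra|]; rewrite hat_theta_factor; fold F m; rewrite Eh; ring.
- intros t [Ht Et]; rewrite hat_theta_factor in Et; fold F m in Et.
  assert (Hp := exp_pos (cot a * t)).
  assert (E : F t - m = 0) by (apply Rmult_integral in Et; lra).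
  destruct (Rtotal_order h t) as [H|[H|H]]; [|exact H|].
  + assert (H' := Habove t ltac:(lra)); lra.
  + assert (H' := Hinc t h ltac:(lra) H ltac:(lra)); lra.
- intros t Ht; assert (H := hat_theta_factor a t); fold F m in H.
  assert (Hp := exp_pos (cot a * t)); assert (H' := Habove t Ht).
  assert (0 < exp (cot a * t) * (F t - m)) by (apply Rmult_lt_0_compat; lra).
  lra.
Qed.

(** This is where the equation for the angle enters: exponentiated, it reads
    [sin a / (2 PI + a) = exp (1 - (2 PI + a) cot a)], so that the strength of the
    second source becomes the threshold in the equation for [hat_theta]. *)
Lemma S1_boundary a t : is_bar_alpha a ->
  S1 a t = - exp (- cot a * (2 * PI + a - t)) * exp (tau1 a t).
Proof.
intros [Ha E]; assert (HPI := PI_RGT_0).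
assert (Hs : 0 < sin a) by (apply sin_gt_0; lra).
assert (H : sin a / (2 * PI + a) = exp (1 - (2 * PI + a) * cot a)).
{ replace (1 - (2 * PI + a) * cot a) with (- ln ((2 * PI + a) / sin a)) by lra.
  rewrite exp_Ropp, exp_ln by (apply Rdiv_lt_0_compat; lra).
  field; lra. }
unfold S1, tau1, bar_c; rewrite H, !Ropp_mult_distr_l_reverse, <- !exp_plus.
f_equal; f_equal; field; lra.
Qed.

Lemma rho_reg_pos_first_turn a tau t : is_bar_alpha a -> 0 < t <= PI -> 0 <= tau < 1 ->
  (tau1 a t <= tau ->
   exp (- cot a * (2 * PI + a - t)) < cot a * ((1 - cos t) / sin a)) ->
  0 < rho_reg a tau t.
Proof.
intros Ha Ht Htau Hgap; unfold rho_reg.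
destruct (bar_alpha_numerics a Ha) as (HL & _).
rewrite (g_neg (tau - 2)), (g_neg (tau - 1)), (g_unit tau) by lra.
assert (He := exp_pos tau); assert (H0 := S0_pos a t Ha Ht).
assert (Hr : 0 < t / (2 * PI + a) < 1).
{ split; [apply Rdiv_lt_0_compat; lra|].
  apply Rmult_lt_reg_r with (2 * PI + a); [lra|].
  assert (HPI := PI_RGT_0); assert (Ha' := proj1 (proj1 Ha)).
  unfold Rdiv; rewrite Rmult_assoc, Rinv_l; lra. }
assert (Hr' : 0 < tau1 a t < 1) by (unfold tau1; lra).
destruct (Rlt_le_dec tau (tau1 a t)) as [H|H].
- rewrite (g_neg (tau - tau1 a t)) by lra; nra.
- rewrite (g_unit (tau - tau1 a t)) by lra.
  rewrite (S1_boundary a t Ha); fold (S0 a t) in Hgap.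
  replace (- exp (- cot a * (2 * PI + a - t)) * exp (tau1 a t) * exp (tau - tau1 a t))
    with (- exp (- cot a * (2 * PI + a - t)) * exp tau)
    by (rewrite Rmult_assoc, <- exp_plus; do 2 f_equal; ring).
  assert (H' := Hgap H); nra.
Qed.

(** * Growth, and the theorem *)

Lemma is_lim_rho_reg a t :
  is_lim (fun tau => rho_reg a tau t / tau) p_infty
    (2 * (S0 a t + S1 a t + S2 a t + S3 a t)).
Proof.
assert (H : forall k b, is_lim (fun tau => k * (g (tau - b) / tau)) p_infty (k * 2))
  by (intros k b; apply (is_lim_scal_l _ k p_infty 2), is_lim_g_shift).
replace (2 * (S0 a t + S1 a t + S2 a t + S3 a t))
  with (S0 a t * 2 + S1 a t * 2 + S2 a t * 2 + S3 a t * 2) by ring.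
apply is_lim_ext with
  (fun tau => S0 a t * (g (tau - 0) / tau) + S1 a t * (g (tau - tau1 a t) / tau)
              + S2 a t * (g (tau - 1) / tau) + S3 a t * (g (tau - 2) / tau)).
- intros tau; unfold rho_reg, Rdiv; rewrite Rminus_0_r; ring.
- do 3 (apply is_lim_plus'; [|apply H]); apply H.
Qed.

Theorem proposition1p22 :
  forall alpha : R, is_bar_alpha alpha ->
  (exists hat_theta : R,
     unique (is_hat_theta alpha) hat_theta /\
     (forall tau theta : R,
        0 <= tau -> 0 <= theta <= PI ->
        ~ N_segm alpha hat_theta tau theta ->
        rho_pos alpha tau theta)) /\
  (forall theta : R, 0 <= theta <= PI ->
     is_lim (fun tau => rho_reg alpha tau theta / tau) p_infty
       (2 * (S0 alpha theta + S1 alpha theta + S2 alpha theta + S3 alpha theta))) /\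
  (forall theta : R, 0 < theta <= PI ->
     theta ^ 2 * 0.08
     < 2 * (S0 alpha theta + S1 alpha theta + S2 alpha theta + S3 alpha theta)
     < theta ^ 2 * 0.28).
Proof.
intros a Ha; split; [|split].
- destruct (hat_theta_spec a Ha) as [h [Hu Hh]]; exists h; split; [exact Hu|].
  intros tau t Htau Ht HN; unfold N_segm in HN.
  assert (Ht0 : 0 < t) by (destruct (Req_dec t 0); [tauto|lra]).
  split.
  + intros ->; unfold D.
    destruct (bar_alpha_numerics a Ha) as (HL & _).
    apply Rdiv_lt_0_compat; [|lra].
    assert (Ht2 : t < 2 * a) by (apply Rnot_le_lt; intros H; apply HN; lra).
    assert (H := cos_shift_gt a t (proj1 Ha) ltac:(lra)); lra.
  + intros Hne; destruct (Rlt_le_dec tau 1) as [H1|H1].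
    * apply rho_reg_pos_first_turn; [exact Ha|lra|lra|].
      intros Hge; apply Hh; split; [|lra].
      apply Rnot_le_lt; intros H; apply HN; left.
      unfold tau1 in Hge; lra.
    * destruct (Rlt_le_dec tau 2) as [H2|H2].
      -- apply rho_reg_pos_second_turn; [exact Ha|lra|lra].
      -- apply rho_reg_pos_after_second_turn; [exact Ha|lra|lra].
- intros t _; apply is_lim_rho_reg.
- intros t Ht; split; [now apply mass_lower|now apply mass_upper].
Qed.
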